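(* Let $\mathbf{x}(s)$, $s\in I$, be a multiplicative twisted curve in $\mathbb{E}_*^3$ parametrized by multiplicative arc length, with multiplicative curvature $\kappa$, multiplicative torsion $\tau$ and multiplicative Frenet frame $\{\mathbf{t},\mathbf{n},\mathbf{b}\}$. Let $\mathbb{S}_*^2$ be the multiplicative sphere of radius $r>0_*$ centered at $\mathbf{0}_*$. If $\mathbf{x}(s)\in\mathbb{S}_*^2$ for all $s\in I$, then for all $s \in I$ $$\mathbf{x}(s)=(e^{-1}/_*\kappa(s))\cdot_*\mathbf{n}(s)+_*\big((e^{-1}/_*\kappa(s))^*/_*\tau(s)\big)\cdot_*\mathbf{b}(s),$$ or equivalently, for $i=1,2,3$, $$x_i(s)=\exp\left(-\frac{\log n_i(s)}{\log\kappa(s)}+\frac{\log\big[(e^{-1/\log\kappa(s)})^*\big]\,\log b_i(s)}{\log\tau(s)}\right).$$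
   Context: Multiplicative arithmetic. $\mathbb{R}_*$ is the set of positive reals with the field operations $a+_*b=e^{\log a+\log b}$, $a-_*b=e^{\log a-\log b}$, $a\cdot_*b=e^{\log a\log b}$, $a/_*b=e^{\log a/\log b}$ ($b\ne1$); $0_*=1$, $1_*=e$; $>$ is the usual order. Also $a^{2_*}=e^{(\log a)^2}$ and $a^{\frac12_*}=e^{\sqrt{\log a}}$ (for $a\ge 1$). Multiplicative derivative. For $f:I\to\mathbb{R}_*$, $I\subset\mathbb{R}_*$ an interval, $f^*(s)=\lim_{h\to1}(f(s+_*h)-_*f(s))/_*h=e^{s(\log f(s))'}$, with $'$ the usual derivative. All functions are multiplicative differentiable to whatever order is needed. For vector-valued functions the derivative is taken componentwise. Multiplicative Euclidean space. $\mathbb{E}_*^3$ is $\mathbb{R}_*^3$ with $\mathbf{x}+_*\mathbf{y}=(x_iy_i)_i$, $a\cdot_*\mathbf{x}=(e^{\log a\log x_i})_i$, zero vector $\mathbf{0}_*=(1,1,1)$, inner product $\langle\mathbf{x},\mathbf{y}\rangle_*=e^{\sum_i\log x_i\log y_i}$, norm $\|\mathbf{x}\|_*=\langle\mathbf{x},\mathbf{x}\rangle_*^{\frac12_*}=e^{\sqrt{\sum_i(\log x_i)^2}}$. Cross product: $\mathbf{x}\times_*\mathbf{y}=(e^{\log x_2\log y_3-\log x_3\log y_2},e^{\log x_3\log y_1-\log x_1\log y_3},e^{\log x_1\log y_2-\log x_2\log y_1})$. Vectors are multiplicative collinear iff their cross product is $\mathbf{0}_*$. Subtraction of vectors and scalar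 division $\mathbf{x}/_*a$ are componentwise. The multiplicative sphere of radius $r>0_*$ centered at $\mathbf{0}_*$ is $\{Q\in\mathbb{E}_*^3:\|Q\|_*=r\}$. Curves. $\mathbf{x}:I\to\mathbb{E}_*^3$ is parametrized by multiplicative arc length if $\|\mathbf{x}^*(s)\|_*=1_*$ for all $s$; it is multiplicative biregular if $\mathbf{x}^*(s)$ and $\mathbf{x}^{**}(s)$ are nowhere multiplicative collinear. The multiplicative Frenet frame of a biregular arc length parametrized curve is $\mathbf{t}=\mathbf{x}^*$, $\mathbf{n}=\mathbf{x}^{**}/_*\|\mathbf{x}^{**}\|_*$, $\mathbf{b}=\mathbf{t}\times_*\mathbf{n}$, with components $t_i,n_i,b_i$. The multiplicative curvature and torsion are $\kappa=\|\mathbf{x}^{**}\|_*$ and $\tau=\langle\mathbf{n}^*,\mathbf{b}\rangle_*$. The curve is multiplicative twisted if $\kappa$ and $\tau$ are nowhere equal to $0_*$. *)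

(* Defs.v *)
From HB Require Import structures.
From mathcomp Require Import all_boot all_order all_algebra.
From mathcomp Require Import all_classical all_reals all_analysis.
Import Order.TTheory GRing.Theory Num.Theory.
Import numFieldNormedType.Exports.

Set Implicit Arguments.
Unset Strict Implicit.
Unset Printing Implicit Defensive.

Local Open Scope classical_set_scope.
Local Open Scope ring_scope.

(* Multiplicative numbers are represented by reals, with positivity required
   where it matters; every operation below has positive values.  The library
   sets [ln a = 0] for [a <= 0] and [y / 0 = 0], so that [mdiv a 1 = 1] is a
   junk value. *)
Section MultiplicativeArithmetic.
Context {R : realType}.
Implicit Types a b : R.

Definition mreal : set R := [set a | 0 < a].

Definition star0 : R := 1.
Definition star1 : R := expR 1.

Definition madd a b : R := expR (ln a + ln b).
Definition msub a b : R := expR (ln a - ln b).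
Definition mmul a b : R := expR (ln a * ln b).
Definition mdiv a b : R := expR (ln a / ln b).
Definition msqrt a : R := expR (Num.sqrt (ln a)).

End MultiplicativeArithmetic.

Section MultiplicativeDerivative.
Context {R : realType}.
Implicit Types (I : set R) (f : R -> R) (s h : R).

Definition mquotient f s h : R := mdiv (msub (f (madd s h)) (f s)) h.

(* h tends to 0_* = 1 with h <> 1 and s +_* h in I: the derivative is two-sided
   at interior points of I and one-sided at endpoints belonging to I. *)
Definition mincrement I s : set_system R :=
  within [set h | I (madd s h)] (star0^').

(* The limit has to lie in R_*: a quotient tending to the real number 0 does
   not make f multiplicative differentiable. *)
Definition mderivable I f s : Prop :=
  exists2 l : R, mreal l & mquotient f s h @[h --> mincrement I s] --> l.

Definition mderive I f s : R := lim (mquotient f s h @[h --> mincrement I s]).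

Definition mderivable_upto I (k : nat) f : Prop :=
  forall j, (j < k)%N -> forall s, I s -> mderivable I (iter j (mderive I) f) s.

End MultiplicativeDerivative.

Section MultiplicativeSpace.
Context {R : realType}.
Implicit Types (u v : 'rV[R]_3) (a r : R).

Definition mspace : set 'rV[R]_3 := [set u | forall i, mreal (u ord0 i)].

Definition mvzero : 'rV[R]_3 := const_mx star0.
Definition mvadd u v : 'rV[R]_3 := \row_i madd (u ord0 i) (v ord0 i).
Definition mvscale a u : 'rV[R]_3 := \row_i mmul a (u ord0 i).
Definition mvdiv u a : 'rV[R]_3 := \row_i mdiv (u ord0 i) a.

Definition minner u v : R := expR (\sum_i ln (u ord0 i) * ln (v ord0 i)).
Definition mnorm u : R := msqrt (minner u u).

(* The indices i + 1 and i + 2 are taken in 'I_3, that is, modulo 3. *)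
Definition mcross u v : 'rV[R]_3 :=
  \row_(i < 3) expR (ln (u ord0 (i + 1)) * ln (v ord0 (i + 2))
                     - ln (u ord0 (i + 2)) * ln (v ord0 (i + 1))).

Definition mcollinear u v : Prop := mcross u v = mvzero.

Definition msphere r : set 'rV[R]_3 := [set Q | mspace Q /\ mnorm Q = r].

End MultiplicativeSpace.

Section MultiplicativeCurves.
Context {R : realType}.
Implicit Types (I : set R) (x : R -> 'rV[R]_3) (s : R).

(* The order of R_* is the usual one, hence so are its intervals; those with
   at most one point are excluded because nothing can be differentiated on
   them. *)
Definition minterval I : Prop :=
  [/\ is_interval I, I `<=` mreal & exists a b, [/\ I a, I b & a < b]].

Definition mvderive I x s : 'rV[R]_3 :=
  \row_i mderive I (fun u => x u ord0 i) s.

Definition mvderivable_upto I (k : nat) x : Prop :=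
  forall i, mderivable_upto I k (fun u => x u ord0 i).

Definition marc_length I x : Prop :=
  forall s, I s -> mnorm (mvderive I x s) = star1.

Definition mbiregular I x : Prop :=
  forall s, I s ->
    ~ mcollinear (mvderive I x s) (mvderive I (mvderive I x) s).

Definition mtangent I x : R -> 'rV[R]_3 := mvderive I x.

Definition mcurvature I x s : R := mnorm (mvderive I (mvderive I x) s).

Definition mnormal I x s : 'rV[R]_3 :=
  mvdiv (mvderive I (mvderive I x) s) (mcurvature I x s).

Definition mbinormal I x s : 'rV[R]_3 :=
  mcross (mtangent I x s) (mnormal I x s).

Definition mtorsion I x s : R :=
  minner (mvderive I (mnormal I x) s) (mbinormal I x s).

Definition mtwisted I x : Prop :=
  forall s, I s -> mcurvature I x s <> star0 /\ mtorsion I x s <> star0.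

End MultiplicativeCurves.

(* Main.v *)
(* Taking logarithms turns the multiplicative curve into a Euclidean unit speed
   curve y (for the derivative f |-> s f'(s)) with frame T, N, B, curvature K
   and torsion W.  Differentiating <y, y> = (ln r)^2 three times gives
   <y, T> = 0, <y, N> = - 1 / K and <y, N'> = (- 1 / K)'.  Since
   N' = <N', T> T + W B, the last relation is W <y, B> = (- 1 / K)', so that
   all the coordinates of y in the frame are known. *)
Require Import Defs.
From HB Require Import structures.
From mathcomp Require Import all_boot all_order all_algebra.
From mathcomp Require Import all_classical all_reals all_analysis.
From mathcomp Require Import ring lra.
Import Order.TTheory GRing.Theory Num.Theory.
Import numFieldNormedType.Exports.

Set Implicit Arguments.
Unset Strict Implicit.
Unset Printing Implicit Defensive.

Local Open Scope classical_set_scope.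
Local Open Scope ring_scope.

(** * Euclidean algebra in dimension three *)

Definition dot {R : realType} (u v : 'rV[R]_3) : R :=
  \sum_i u ord0 i * v ord0 i.

Definition cross {R : realType} (u v : 'rV[R]_3) : 'rV[R]_3 :=
  \row_(i < 3) (u ord0 (i + 1) * v ord0 (i + 2)
                - u ord0 (i + 2) * v ord0 (i + 1)).

Definition lnv {R : realType} (u : 'rV[R]_3) : 'rV[R]_3 := map_mx (@ln R) u.

Lemma big_ord3 (R : realType) (f : 'I_3 -> R) :
  \sum_i f i = f 0 + f 1 + f 2.
Proof.
rewrite !big_ord_recl big_ord0 addr0 addrA.
by congr (f _ + f _ + f _); apply: val_inj.
Qed.

Lemma dotC (R : realType) (u v : 'rV[R]_3) : dot u v = dot v u.
Proof. by apply: eq_bigr => i _; rewrite mulrC. Qed.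

Lemma dotZl (R : realType) (a : R) (u v : 'rV[R]_3) :
  dot (a *: u) v = a * dot u v.
Proof. by rewrite /dot mulr_sumr; apply: eq_bigr => i _; rewrite mxE mulrA. Qed.

Lemma dotZr (R : realType) (a : R) (u v : 'rV[R]_3) :
  dot u (a *: v) = a * dot u v.
Proof. by rewrite dotC dotZl dotC. Qed.

Lemma dotDr (R : realType) (u v w : 'rV[R]_3) :
  dot u (v + w) = dot u v + dot u w.
Proof. by rewrite /dot -big_split; apply: eq_bigr => i _; rewrite mxE mulrDr. Qed.

Lemma dot_ge0 (R : realType) (u : 'rV[R]_3) : 0 <= dot u u.
Proof. by apply: sumr_ge0 => i _; rewrite -expr2 sqr_ge0. Qed.

Lemma ord3_arith :
  ((0 + 1)%R = 1%R :> 'I_3) * ((0 + 2)%R = 2%R :> 'I_3) *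
  ((1 + 1)%R = 2%R :> 'I_3) * ((1 + 2)%R = 0%R :> 'I_3) *
  ((2 + 1)%R = 0%R :> 'I_3) * ((2 + 2)%R = 1%R :> 'I_3).
Proof. by do !split; apply: val_inj. Qed.

Lemma dot_cross_l (R : realType) (u v : 'rV[R]_3) : dot u (cross u v) = 0.
Proof. rewrite /dot big_ord3 !mxE !ord3_arith; ring. Qed.

Lemma dot_cross_r (R : realType) (u v : 'rV[R]_3) : dot v (cross u v) = 0.
Proof. rewrite /dot big_ord3 !mxE !ord3_arith; ring. Qed.

(** Lagrange's identity; it makes the third frame vector a unit vector. *)
Lemma dot_cross (R : realType) (u v : 'rV[R]_3) :
  dot (cross u v) (cross u v) = dot u u * dot v v - dot u v ^+ 2.
Proof. rewrite /dot !big_ord3 !mxE !ord3_arith; ring. Qed.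

(** The matrix [M] with rows [u], [v], [cross u v] satisfies [M *m M^T = 1]. A one-sided inverse of
    a square matrix is two-sided, so [w = w *m M^T *m M], which is the expansion. *)
Lemma orthonormal_expansion (R : realType) (u v w : 'rV[R]_3) :
  dot u u = 1 -> dot v v = 1 -> dot u v = 0 ->
  w = dot w u *: u + dot w v *: v + dot w (cross u v) *: cross u v.
Proof.
move=> uu vv uv.
pose F : 'I_3 -> 'rV[R]_3 := fun i => if i == 0 then u else if i == 1 then v else cross u v.
pose M : 'M[R]_3 := \matrix_i F i.
have MMT : M *m M^T = 1%:M.
  apply/matrixP => i j; rewrite !mxE.
  transitivity (dot (F i) (F j)).
    by apply: eq_bigr => k _; rewrite !mxE.
  have cc : dot (cross u v) (cross u v) = 1 by rewrite dot_cross uu vv uv; ring.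
  have ord3P (k : 'I_3) : [\/ k = 0, k = 1 | k = 2].
    by case: k => -[|[|[|m]]] // p; [apply: Or31|apply: Or32|apply: Or33];
      apply: val_inj.
  have cu : dot (cross u v) u = 0 by rewrite dotC dot_cross_l.
  have cv : dot (cross u v) v = 0 by rewrite dotC dot_cross_r.
  have vu : dot v u = 0 by rewrite dotC.
  by case: (ord3P i) => ->; case: (ord3P j) => ->; rewrite /F /=
    ?uu ?vv ?uv ?vu ?cc ?cu ?cv ?dot_cross_l ?dot_cross_r.
have {MMT}MTM := mulmx1C MMT.
rewrite -[LHS]mulmx1 -MTM mulmxA; apply/rowP => j.
rewrite !mxE big_ord3 !mxE /F /=.
by rewrite -!/(dot _ _); congr (_ * _ + _ * _ + _ * _); apply: eq_bigr => k _;
  rewrite !mxE.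
Qed.

(** * Logarithmic derivatives and the filter of multiplicative increments *)

(* The multiplicative derivative of [f] at [s] is [expR d] where [d] satisfies
   [is_lderive I (ln \o f) s d]; intrinsically [d] is [s * (ln \o f)'(s)]. *)
Definition is_lderive {R : realType} (I : set R) (g : R -> R) (s d : R) : Prop :=
  (g (madd s h) - g s) / ln h @[h --> mincrement I s] --> d.

Definition is_vlderive {R : realType} (I : set R) (u : R -> 'rV[R]_3) (s : R)
  (u' : 'rV[R]_3) : Prop :=
  forall i, is_lderive I (fun t => u t ord0 i) s (u' ord0 i).

Instance mincrement_filter (R : realType) (I : set R) (s : R) :
  Filter (mincrement I s).
Proof. exact: within_filter. Qed.

(** Properness is what makes limits, hence derivatives, unique; it rests on [I] having a second
    point. *)
Lemma mincrement_proper (R : realType) (I : set R) (s : R) :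
  minterval I -> I s -> ProperFilter (mincrement I s).
Proof.
move=> [itvI Ipos [a [b [Ia Ib ab]]]] Is.
have [c Ic cs] : exists2 c, I c & c != s.
  have [eas|] := eqVneq a s; last by exists a.
  by exists b => //; rewrite -eas gt_eqF.
have s0 : 0 < s := Ipos _ Is.
have c0 : 0 < c := Ipos _ Ic.
pose k := ln c - ln s.
have k0 : k != 0.
  by apply: contra_neq cs => /subr0_eq cs; apply: ln_inj; rewrite ?posrE.
(* The increments [expR (t * k)] with [0 < t < 1] move [s] towards [c] on the logarithmic scale.
   They differ from 1 since [k != 0], and the moved point stays in [I] because [I] is an
   interval. *)
have Eto : expR (t * k) @[t --> (0 : R)^'+] --> mincrement I s.
  move=> P /= [e /= e0 eP].
  have : expR (t * k) @[t --> (0 : R)^'+] --> (1 : R).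
    have -> : (1 : R) = expR (0 * k) by rewrite mul0r expR0.
    apply: cvg_at_right_filter.
    apply: (@continuous_comp R R R ( *%R^~ k) expR 0); last exact: continuous_expR.
    by apply: cvgM; [exact: cvg_id|exact: cvg_cst].
  move=> /(_ _ (nbhsx_ballx _ _ e0)) near1.
  change (\forall t \near (0 : R)^'+, P (expR (t * k))).
  change (\forall t \near (0 : R)^'+, ball (1 : R) e (expR (t * k))) in near1.
  near=> t.
  have t0 : 0 < t by near: t; exact: nbhs_right_gt.
  have t1 : t < 1 by near: t; exact: nbhs_right_lt.
  have Et : ball (1 : R) e (expR (t * k)) by near: t.
  apply: eP => //=.
    by rewrite /star0 -expR0 (inj_eq (@expR_inj R)) mulf_neq0 // gt_eqF.
  rewrite /madd expRK.
  have mon (p q : R) : I (expR p) -> I (expR q) -> forall z, p <= z <= q -> I (expR z).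
    by move=> Ip Iq z /andP[pz zq]; apply: (itvI _ _ Ip Iq); rewrite !ler_expR pz.
  have [ks|ks] := leP 0 k.
    apply: (mon (ln s) (ln c)); rewrite ?lnK ?posrE //.
    by rewrite /k in ks *; nra.
  apply: (mon (ln c) (ln s)); rewrite ?lnK ?posrE //.
  by rewrite /k in ks *; nra.
by apply: Build_ProperFilter_ex => P /Eto; exact: filter_ex.
Unshelve. all: by end_near.
Qed.

Lemma ln_mincrement (R : realType) (I : set R) (s : R) :
  ln h @[h --> mincrement I s] --> (0 : R).
Proof.
rewrite -ln1; apply: cvg_trans; last exact: (@continuous_ln R 1 ltr01).
apply: cvg_app; apply: cvg_trans; first exact: cvg_within.
exact: cvg_within.
Qed.

(** Since [ln] also vanishes at nonpositive reals, [h <> 1] alone is not enough: positivity of [h]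
    near 1 is used too. *)
Lemma near_mincrement_ln_neq0 (R : realType) (I : set R) (s : R) :
  \forall h \near mincrement I s, ln h != 0 :> R.
Proof.
have : \forall h \near (1 : R), 0 < h by exact: lt_nbhsr.
move=> h0; rewrite /mincrement near_withinE /dnbhs near_withinE.
near=> h => h1 _; apply: contra_neq h1 => lh.
have hp : 0 < h by near: h.
by apply: ln_inj; rewrite ?posrE // lh ln1.
Unshelve. all: by end_near.
Qed.

(** * Differentiation rules for logarithmic derivatives *)

Lemma is_lderive_unique (R : realType) (I : set R) (g : R -> R) (s d e : R) :
  minterval I -> I s -> is_lderive I g s d -> is_lderive I g s e -> d = e.
Proof.
move=> hI Is gd ge; have PF := mincrement_proper hI Is.
exact: cvg_unique gd ge.
Qed.

(** The filter sees only increments with [madd s h] in [I], so identities that hold only along the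
    curve can be differentiated. *)
Lemma is_lderive_ext (R : realType) (I : set R) (f g : R -> R) (s d : R) :
  I s -> (forall u, I u -> f u = g u) ->
  is_lderive I f s d -> is_lderive I g s d.
Proof.
move=> Is fg; apply: cvg_trans; apply: near_eq_cvg.
have : \forall h \near mincrement I s, I (madd s h).
  exact: withinT.
by apply: filterS => h Ih; rewrite !fg.
Qed.

(** The identity ranges over all [h]: in the rules below it survives [ln h = 0], where division by
    zero gives 0 on both sides. *)
Lemma is_lderive_of_cvg (R : realType) (I : set R) (g q : R -> R) (s d : R) :
  q h @[h --> mincrement I s] --> d ->
  (forall h, (g (madd s h) - g s) / ln h = q h) -> is_lderive I g s d.
Proof. by move=> qd gq; rewrite /is_lderive; under eq_fun do rewrite gq. Qed.

Lemma is_lderive_cst (R : realType) (I : set R) (c s : R) :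
  is_lderive I (fun=> c) s 0.
Proof.
rewrite /is_lderive; under eq_fun do rewrite subrr mul0r.
exact: cvg_cst.
Qed.

(** Differentiability implies continuity: add to [g s] the quotient times [ln h], which tends to
    0. *)
Lemma is_lderive_cvg (R : realType) (I : set R) (g : R -> R) (s d : R) :
  is_lderive I g s d -> g (madd s h) @[h --> mincrement I s] --> g s.
Proof.
move=> gd.
have : g s + (g (madd s h) - g s) / ln h * ln h @[h --> mincrement I s]
    --> g s + d * 0.
  by apply: cvgD; [exact: cvg_cst|apply: cvgM => //; exact: ln_mincrement].
rewrite mulr0 addr0; apply: cvg_trans; apply: near_eq_cvg.
have := near_mincrement_ln_neq0 I s.
by apply: filterS => h h0; rewrite divfK// addrC subrK.
Qed.

Lemma is_lderiveD (R : realType) (I : set R) (f g : R -> R) (s d e : R) :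
  is_lderive I f s d -> is_lderive I g s e ->
  is_lderive I (fun t => f t + g t) s (d + e).
Proof.
move=> fd ge; apply: (is_lderive_of_cvg (cvgD fd ge)) => h.
rewrite -[RHS]/((f (madd s h) - f s) / ln h + (g (madd s h) - g s) / ln h).
by rewrite -mulrDl; congr (_ / _); ring.
Qed.

Lemma is_lderiveM (R : realType) (I : set R) (f g : R -> R) (s d e : R) :
  is_lderive I f s d -> is_lderive I g s e ->
  is_lderive I (fun t => f t * g t) s (d * g s + f s * e).
Proof.
move=> fd ge.
apply: (is_lderive_of_cvg
  (cvgD (cvgM fd (is_lderive_cvg ge)) (cvgM (cvg_cst (f s)) ge))) => h.
rewrite -[RHS]/((f (madd s h) - f s) / ln h * g (madd s h)
  + f s * ((g (madd s h) - g s) / ln h)); ring.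
Qed.

Lemma is_lderiveN (R : realType) (I : set R) (g : R -> R) (s e : R) :
  is_lderive I g s e -> is_lderive I (fun t => - g t) s (- e).
Proof.
move=> ge; apply: (is_lderive_of_cvg (cvgN ge)) => h.
by rewrite -[RHS]/(- ((g (madd s h) - g s) / ln h)) -mulNr; congr (_ / _); ring.
Qed.

(** Carathéodory's form of the derivative supplies a continuous slope [q], so that nothing is
    divided by [g (madd s h) - g s], which may vanish. *)
Lemma is_lderive_comp (R : realType) (I : set R) (phi g : R -> R) (s c d : R) :
  is_derive (g s) 1 phi c -> is_lderive I g s d ->
  is_lderive I (phi \o g) s (c * d).
Proof.
move=> /is_derive1_caratheodory[q [qE qc <-]] gd.
have qg : q (g (madd s h)) @[h --> mincrement I s] --> q (g s).
  exact: (cvg_comp _ _ (is_lderive_cvg gd) qc).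
apply: (is_lderive_of_cvg (cvgM qg gd)) => h.
by rewrite /= qE mulrA.
Qed.

Lemma is_lderive_sum (R : realType) (I : set R) (f : 'I_3 -> R -> R)
  (s : R) (d : 'I_3 -> R) :
  (forall i, is_lderive I (f i) s (d i)) ->
  is_lderive I (fun t => \sum_i f i t) s (\sum_i d i).
Proof.
move=> fd; rewrite (_ : (fun _ => _) = (fun t => f 0 t + f 1 t + f 2 t)).
  by rewrite big_ord3; do !apply: is_lderiveD.
by apply/funext => t; rewrite big_ord3.
Qed.

Lemma is_vlderiveZ (R : realType) (I : set R) (k : R -> R) (u : R -> 'rV[R]_3)
  (s k' : R) (u' : 'rV[R]_3) :
  is_lderive I k s k' -> is_vlderive I u s u' ->
  is_vlderive I (fun t => k t *: u t) s (k' *: u s + k s *: u').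
Proof.
move=> kk' uu' i; rewrite !mxE; under eq_fun do rewrite mxE.
exact: is_lderiveM kk' (uu' i).
Qed.

Lemma is_lderive_dot (R : realType) (I : set R) (u v : R -> 'rV[R]_3) (s : R)
  (u' v' : 'rV[R]_3) :
  is_vlderive I u s u' -> is_vlderive I v s v' ->
  is_lderive I (fun t => dot (u t) (v t)) s (dot u' (v s) + dot (u s) v').
Proof.
move=> uu' vv'; rewrite /dot -big_split /=.
by apply: is_lderive_sum => i; apply: is_lderiveM.
Qed.

(** Product rule against the zero derivative of a constant; every orthogonality relation of the
    frame comes from here. *)
Lemma is_lderive_dot_cst (R : realType) (I : set R) (u v : R -> 'rV[R]_3)
  (s c : R) (u' v' : 'rV[R]_3) :
  minterval I -> I s -> (forall t, I t -> dot (u t) (v t) = c) ->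
  is_vlderive I u s u' -> is_vlderive I v s v' ->
  dot u' (v s) + dot (u s) v' = 0.
Proof.
move=> hI Is uvc uu' vv'.
apply: (is_lderive_unique hI Is (is_lderive_dot uu' vv')).
by apply: (is_lderive_ext Is _ (is_lderive_cst I c s)) => t It; rewrite uvc.
Qed.

(** * Translation of multiplicative notions into Euclidean ones by logarithms *)

Lemma mquotientE (R : realType) (f : R -> R) (s h : R) :
  mquotient f s h = expR ((ln (f (madd s h)) - ln (f s)) / ln h).
Proof. by rewrite /mquotient /mdiv /msub expRK. Qed.

Lemma mderive_lderive (R : realType) (I : set R) (f : R -> R) (s d : R) :
  minterval I -> I s -> is_lderive I (@ln R \o f) s d -> mderive I f s = expR d.
Proof.
move=> hI Is fd; have PF := mincrement_proper hI Is.
apply: cvg_lim => //.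
under eq_fun do rewrite mquotientE.
exact: (cvg_comp _ _ fd (@continuous_expR R d)).
Qed.

(** The limit [l] is positive by definition of [mderivable], so [ln] is continuous there and passes
    through the limit. *)
Lemma mderivable_lderive (R : realType) (I : set R) (f : R -> R) (s : R) :
  minterval I -> I s -> mderivable I f s ->
  is_lderive I (@ln R \o f) s (ln (mderive I f s)).
Proof.
move=> hI Is [l l0 fl]; have PF := mincrement_proper hI Is.
rewrite /mderive (cvg_lim _ fl)//.
have := cvg_comp _ _ fl (@continuous_ln R l l0).
move=> /is_lderive_of_cvg; apply => h /=.
by rewrite mquotientE expRK.
Qed.

Lemma lnvE (R : realType) (u : 'rV[R]_3) (i : 'I_3) :
  lnv u ord0 i = ln (u ord0 i).
Proof. by rewrite mxE. Qed.

Lemma minnerE (R : realType) (u v : 'rV[R]_3) :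
  minner u v = expR (dot (lnv u) (lnv v)).
Proof. by congr expR; apply: eq_bigr => i _; rewrite !lnvE. Qed.

Lemma ln_mnorm (R : realType) (u : 'rV[R]_3) :
  ln (mnorm u) = Num.sqrt (dot (lnv u) (lnv u)).
Proof. by rewrite /mnorm /msqrt minnerE !expRK. Qed.

Lemma lnv_mcross (R : realType) (u v : 'rV[R]_3) :
  lnv (mcross u v) = cross (lnv u) (lnv v).
Proof. by apply/rowP => i; rewrite !mxE expRK. Qed.

Lemma lnv_mvdiv (R : realType) (u : 'rV[R]_3) (a : R) :
  lnv (mvdiv u a) = (ln a)^-1 *: lnv u.
Proof. by apply/rowP => i; rewrite !mxE expRK mulrC. Qed.

(** Taken at the squared length of the acceleration, this yields differentiability of the inverse
    curvature. *)
Lemma is_derive_sqrtV (R : realType) (y : R) :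
  0 < y -> exists c, is_derive y 1 (fun z : R => (Num.sqrt z)^-1) c.
Proof.
move=> y0.
have sq0 : Num.sqrt y != 0 by rewrite gt_eqF// sqrtr_gt0.
have dsq := is_derive1_sqrt y0.
by eexists; apply: is_deriveV.
Qed.

(** * Euclidean unit speed curves on a sphere centered at the origin *)

Lemma spherical_curve_expansion (R : realType) (I : set R) (s c D W : R)
    (y T A N : R -> 'rV[R]_3) (K : R -> R) (N' : 'rV[R]_3) :
  minterval I -> I s ->
  (forall u, I u -> is_vlderive I y u (T u)) ->
  (forall u, I u -> is_vlderive I T u (A u)) ->
  is_vlderive I N s N' ->
  (forall u, I u -> dot (y u) (y u) = c) ->
  (forall u, I u -> dot (T u) (T u) = 1) ->
  (forall u, I u -> K u = Num.sqrt (dot (A u) (A u))) ->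
  (forall u, I u -> K u != 0) ->
  (forall u, I u -> N u = (K u)^-1 *: A u) ->
  is_lderive I (fun u => - (K u)^-1) s D ->
  W = dot N' (cross (T s) (N s)) -> W != 0 ->
  forall i, y s ord0 i =
    - (N s ord0 i / K s) + D * cross (T s) (N s) ord0 i / W.
Proof.
move=> hI Is dy dT dN yy TT KE K0 NE dK WE W0.
have yT u : I u -> dot (y u) (T u) = 0.
  move=> Iu; have := is_lderive_dot_cst hI Iu yy (dy _ Iu) (dy _ Iu).
  by rewrite (dotC (T u)); lra.
have TA u : I u -> dot (T u) (A u) = 0.
  move=> Iu; have := is_lderive_dot_cst hI Iu TT (dT _ Iu) (dT _ Iu).
  by rewrite (dotC (A u)); lra.
(* Differentiating [dot (y u) (T u) = 0] gives [dot (T u) (T u) + dot (y u) (A u) = 0]. *)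
have yA u : I u -> dot (y u) (A u) = -1.
  move=> Iu; have := is_lderive_dot_cst hI Iu yT (dy _ Iu) (dT _ Iu).
  by rewrite TT//; lra.
have AA u : I u -> dot (A u) (A u) = K u ^+ 2.
  by move=> Iu; rewrite KE// sqr_sqrtr// dot_ge0.
have NN u : I u -> dot (N u) (N u) = 1.
  by move=> Iu; rewrite NE// dotZl dotZr AA//; field; exact: K0.
have TN u : I u -> dot (T u) (N u) = 0.
  by move=> Iu; rewrite NE// dotZr TA// mulr0.
have yN u : I u -> dot (y u) (N u) = - (K u)^-1.
  by move=> Iu; rewrite NE// dotZr yA// mulrN1.
(* The derivative of [dot (y u) (N u)] is computed twice: by the product rule, where [TN] removes
   one term, and as the derivative [D] of [- (K u)^-1]. *)
have yN' : dot (y s) N' = D.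
  apply: (is_lderive_unique hI Is _ dK).
  have := is_lderive_dot (dy _ Is) dN.
  by rewrite TN// add0r; apply: is_lderive_ext.
have NN' : dot N' (N s) = 0.
  have := is_lderive_dot_cst hI Is NN dN dN.
  by rewrite (dotC (N s)); lra.
have := orthonormal_expansion N' (TT _ Is) (NN _ Is) (TN _ Is).
rewrite NN' scale0r addr0 -WE => N'E.
(* In the expansion of [N'] the [N] component is zero by [NN'], and pairing with [y s] removes the
   [T] component by [yT]; what remains is [D = W * dot (y s) (cross (T s) (N s))]. *)
have yB : dot (y s) (cross (T s) (N s)) = D / W.
  move: yN'; rewrite [in LHS]N'E dotDr !dotZr yT// mulr0 add0r => <-.
  by rewrite mulrC mulKf.
move=> i.
rewrite {1}(orthonormal_expansion (y s) (TT _ Is) (NN _ Is) (TN _ Is)).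
rewrite yT// scale0r add0r yN// yB !mxE; ring.
Qed.

(** * Return to multiplicative notation *)

Lemma mvadd_mvscale_coord (R : realType) (k t d : R) (w u v : 'rV[R]_3) :
  (forall i, w ord0 i =
    expR (- (ln (u ord0 i) / ln k) + ln d * ln (v ord0 i) / ln t)) ->
  w = mvadd (mvscale (mdiv (expR (-1)) k) u) (mvscale (mdiv d t) v).
Proof.
(* Each intermediate value is an exponential, so the nested logarithms cancel without any positivity
   condition. *)
move=> wE; apply/rowP => i; rewrite wE !mxE /madd /mmul /mdiv !expRK.
by congr expR; ring.
Qed.

Unset Implicit Arguments.

Theorem proposition3p3 (R : realType) (I : set R) (x : R -> 'rV[R]_3) (r : R)
  (hI : minterval I)
  (hx : forall s, I s -> mspace (x s))
  (hdiff : mvderivable_upto I 3 x)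
  (harc : marc_length I x)
  (hbireg : mbiregular I x)
  (htwist : mtwisted I x)
  (hr : star0 < r)
  (hsphere : forall s, I s -> msphere r (x s)) :
  let kappa := mcurvature I x in
  let tau := mtorsion I x in
  let n := mnormal I x in
  let b := mbinormal I x in
  (forall s, I s ->
     x s = mvadd (mvscale (mdiv (expR (-1)) (kappa s)) (n s))
                 (mvscale (mdiv (mderive I (fun u => mdiv (expR (-1)) (kappa u)) s)
                                (tau s))
                          (b s))) /\
  (forall s, I s -> forall i : 'I_3,
     x s ord0 i =
       expR (- (ln (n s ord0 i) / ln (kappa s))
             + ln (mderive I (fun u => expR (-1 / ln (kappa u))) s)
               * ln (b s ord0 i) / ln (tau s))).
Proof.
move=> kappa tau n b.
have kE : (fun u => mdiv (expR (-1)) (kappa u)) = (fun u => expR (-1 / ln (kappa u))).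
  by apply/funext => u; rewrite /mdiv expRK.
suff H s : I s -> forall i : 'I_3,
     x s ord0 i =
       expR (- (ln (n s ord0 i) / ln (kappa s))
             + ln (mderive I (fun u => expR (-1 / ln (kappa u))) s)
               * ln (b s ord0 i) / ln (tau s)).
  split => [s Is|s Is i]; last exact: H.
  by apply: mvadd_mvscale_coord; rewrite kE; exact: H.
pose y u := lnv (x u).
pose T u := lnv (mvderive I x u).
pose A u := lnv (mvderive I (mvderive I x) u).
pose N u := lnv (n u).
pose K u := ln (kappa u).
(* Coordinates of iterated [mvderive] are recast as iterated [mderive], the form in which [hdiff]
   speaks. *)
have x2E i : (fun u => mvderive I x u ord0 i) = mderive I (fun u => x u ord0 i).
  by apply/funext => u; rewrite mxE.
have x3E i : (fun u => mvderive I (mvderive I x) u ord0 i) =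
    mderive I (mderive I (fun u => x u ord0 i)).
  by apply/funext => u; rewrite mxE x2E.
have dln (z : R -> 'rV[R]_3) u : I u ->
    (forall i, mderivable I (fun t => z t ord0 i) u) ->
    is_vlderive I (@lnv R \o z) u (lnv (mvderive I z u)).
  move=> Iu dz i; rewrite lnvE mxE.
  under eq_fun do rewrite /= lnvE.
  exact: mderivable_lderive.
have dy u : I u -> is_vlderive I y u (T u).
  by move=> Iu; apply: dln => // i; apply: (hdiff i 0%N).
have dT u : I u -> is_vlderive I T u (A u).
  by move=> Iu; apply: dln => // i; rewrite x2E; apply: (hdiff i 1%N).
have dA u : I u -> is_vlderive I A u (lnv (mvderive I (mvderive I (mvderive I x)) u)).
  by move=> Iu; apply: dln => // i; rewrite x3E; apply: (hdiff i 2%N).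
have KE u : K u = Num.sqrt (dot (A u) (A u)) by exact: ln_mnorm.
have K0 u : I u -> K u != 0.
  move=> Iu; have [k1 _] := htwist _ Iu; apply/eqP => Ku; apply: k1.
  rewrite -[LHS]lnK ?posrE ?expR_gt0//.
  by rewrite -/(kappa u) -/(K u) Ku expR0.
have NE u : N u = (K u)^-1 *: A u by exact: lnv_mvdiv.
have yy u : I u -> dot (y u) (y u) = ln r ^+ 2.
  move=> Iu; have [_ <-] := hsphere _ Iu.
  by rewrite ln_mnorm sqr_sqrtr// dot_ge0.
have TT u : I u -> dot (T u) (T u) = 1.
  move=> Iu; have := congr1 (@ln R) (harc _ Iu); rewrite ln_mnorm expRK => sT.
  by rewrite -[LHS]sqr_sqrtr ?dot_ge0// sT expr1n.
move=> Is.
(* The square root is differentiable only away from 0; nonvanishing curvature keeps its argument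
   positive. *)
have AA0 : 0 < dot (A s) (A s).
  rewrite lt_neqAle dot_ge0 andbT eq_sym; apply: contra_neq (K0 _ Is) => AA.
  by rewrite KE AA sqrtr0.
(* Third order differentiability enters here through [dA]: [K] is a function of [A], itself of
   second order. *)
have [k' dKV] : exists k', is_lderive I (fun u => (K u)^-1) s k'.
  have [c dc] := is_derive_sqrtV AA0.
  have := is_lderive_comp dc (is_lderive_dot (dA _ Is) (dA _ Is)).
  rewrite (_ : _ \o _ = fun u => (K u)^-1); first by move=> ?; eexists; eassumption.
  by apply/funext => u /=; rewrite KE.
have [N' dN] : exists N', is_vlderive I N s N'.
  eexists; rewrite (_ : N = fun u => (K u)^-1 *: A u); last exact/funext.
  exact: is_vlderiveZ dKV (dA _ Is).
(* [N'] was obtained from the rules for [(K u)^-1 *: A u]; uniqueness of limits identifies it with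
   the logarithm of the derivative occurring in [mtorsion]. *)
have N'E : N' = lnv (mvderive I n s).
  apply/rowP => i; rewrite lnvE mxE (mderive_lderive hI Is (d := N' ord0 i)) ?expRK//.
  by have := dN i; under eq_fun do rewrite lnvE.
have tauE : ln (tau s) = dot N' (cross (T s) (N s)).
  by rewrite /tau /mtorsion minnerE expRK N'E lnv_mcross.
have tau0 : ln (tau s) != 0.
  have [_ t1] := htwist _ Is; apply/eqP => ts; apply: t1.
  rewrite -[LHS]lnK ?posrE ?expR_gt0//.
  by rewrite -/(tau s) ts expR0.
have dD := is_lderiveN dKV.
(* The logarithm of [expR (-1 / ln (kappa u))] is [- (K u)^-1], whose derivative is [- k']. *)
have DE : mderive I (fun u => expR (-1 / ln (kappa u))) s = expR (- k').
  apply: mderive_lderive => //; apply: is_lderive_ext dD => // u _ /=.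
  by rewrite expRK mulN1r.
move=> i.
have E := spherical_curve_expansion hI Is dy dT dN yy TT (fun u _ => KE u) K0
  (fun u _ => NE u) dD tauE tau0 i.
have BE : cross (T s) (N s) ord0 i = ln (b s ord0 i).
  by rewrite -lnv_mcross; exact: lnvE.
have xE : x s ord0 i = expR (y s ord0 i) by rewrite lnvE lnK// posrE; exact: hx.
by rewrite xE E BE DE expRK [N s ord0 i]lnvE.
Qed.
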